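(* Let $\mathcal{U}=\sum_{l=1}^{r}\sigma_{l}\,\mathcal{U}^{(l)}$ be a rank-$r$ canonical tensor and let $U$ be the $N\times r$ matrix whose $l$-th column is $\sigma_l\,\mathcal{U}^{(l)}$ regarded as a vector in $\mathbb{R}^N$. Let $l_1,\dots,l_k\in\{1,\dots,r\}$ be distinct skeleton indices and $P$ a $k\times r$ coefficient matrix giving a rank-$k$ matrix interpolative decomposition of $U$, and let $$\mathcal{U}_{k}=\sum_{m=1}^{k}\alpha_{m}\,\mathcal{U}^{(l_{m})},\qquad \alpha_{m}=\sigma_{l_m}\sum_{l=1}^{r}P_{ml},$$ be the corresponding rank-$k$ tensor interpolative decomposition of $\mathcal{U}$. Let $U_k$ be the $N\times r$ matrix whose $l$-th column is $\mathcal{U}_k^{(l)}=\sum_{m=1}^{k}P_{ml}\,\sigma_{l_m}\,\mathcal{U}^{(l_{m})}$ regarded as a vector in $\mathbb{R}^N$. Then $$\left\Vert \mathcal{U}-\mathcal{U}_{k}\right\Vert _{F}\leq\sqrt{r}\left\Vert U-U_{k}\right\Vert _{F}\leq r\left\Vert U-U_{k}\right\Vert _{2}.$$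
   Context: A rank-$r$ canonical tensor (CTD) is $\mathcal{U}=\sum_{l=1}^r\sigma_l\,\mathcal{U}^{(l)}\in\bigotimes_{j=1}^d\mathbb{R}^{M_j}$ with $\sigma_l>0$ and rank-one terms $\mathcal{U}^{(l)}=\bigotimes_{j=1}^d\mathbf{u}_j^{(l)}$, $\mathbf{u}_j^{(l)}\in\mathbb{R}^{M_j}$, $\|\mathbf{u}_j^{(l)}\|=1$. Tensors are identified with vectors in $\mathbb{R}^N$, $N=\prod_{j=1}^dM_j$. For tensors, $\|\cdot\|_F$ is the Euclidean norm of the array of entries; for matrices, $\|\cdot\|_F$ is the Frobenius norm and $\|\cdot\|_2$ the spectral norm. A rank-$k$ matrix interpolative decomposition of $U$ is an approximation $U\approx U_k=U_cP$, where $U_c$ is the $N\times k$ matrix of the columns of $U$ with indices $l_1,\dots,l_k$ and $P$ is a $k\times r$ coefficient matrix whose columns with indices $l_1,\dots,l_k$ form the $k\times k$ identity matrix. *)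

(* Defs.v *)
From HB Require Import structures.
From mathcomp Require Import all_boot all_order all_algebra.
From mathcomp Require Import boolp classical_sets reals.

Set Implicit Arguments.
Unset Strict Implicit.
Unset Printing Implicit Defensive.

Import Order.TTheory GRing.Theory Num.Theory.

Local Open Scope ring_scope.
Local Open Scope classical_set_scope.

Section Norms.
Context {R : realType}.

(* On column vectors this is the Euclidean norm. *)
Definition normF m n (A : 'M[R]_(m, n)) : R :=
  Num.sqrt (\sum_i \sum_j A i j ^+ 2).

(* The set is nonempty (it contains normF (A *m 0)) and bounded by normF A, so
   that sup is a genuine supremum; this includes the cases m = 0 and n = 0. *)
Definition norm2 m n (A : 'M[R]_(m, n)) : R :=
  sup [set normF (A *m x) | x in [set x : 'cV[R]_n | normF x <= 1]].

End Norms.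

Section Tensors.
Context {R : realType} {d : nat}.
Implicit Type M : 'I_d -> nat.

(* Multi-indices (i_1, ..., i_d) with i_j < M_j; there are N = \prod_j M_j of
   them, see card_multi_index. *)
Definition multi_index M : finType := {dffun forall j : 'I_d, 'I_(M j)}.

Lemma card_multi_index M : #|multi_index M| = (\prod_(j < d) M j)%N.
Proof.
rewrite card_dep_ffun foldrE big_image /=.
by apply: eq_bigr => j _; rewrite card_ord.
Qed.

(* R^o only serves to make tensors a module over R. *)
Definition tensor (R : realType) M : lmodType R := {ffun multi_index M -> R^o}.

Definition tnormF M (T : tensor R M) : R :=
  Num.sqrt (\sum_(i : multi_index M) (T i : R) ^+ 2).

Definition tvec M (T : tensor R M) : 'cV[R]_#|multi_index M| :=
  \col_i (T (enum_val i) : R).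

Definition rank_one M (u : forall j : 'I_d, 'cV[R]_(M j)) : tensor R M :=
  [ffun i : multi_index M => \prod_(j < d) u j (i j) ord0].

(* The matrix whose l-th column is the vectorization of T l. *)
Definition tensor_cols M r (T : 'I_r -> tensor R M) :
    'M[R]_(#|multi_index M|, r) :=
  \matrix_(i, l) tvec (T l) i ord0.

End Tensors.

Record ctd (R : realType) (d : nat) (M : 'I_d -> nat) (r : nat) := CTD {
  ctd_sigma : 'I_r -> R;
  ctd_factor : 'I_r -> forall j : 'I_d, 'cV[R]_(M j);
  ctd_sigma_gt0 : forall l, 0 < ctd_sigma l;
  ctd_factor_unit : forall l j, normF (ctd_factor l j) = 1
}.

Section InterpolativeDecomposition.
Context {R : realType}.

(* Skeleton indices sk and coefficient matrix P of a rank-k matrix interpolative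
   decomposition; the approximation to U they give is matrix_id_approx. *)
Definition matrix_id_data r k (sk : 'I_k -> 'I_r) (P : 'M[R]_(k, r)) : Prop :=
  injective sk /\ colsub sk P = 1%:M.

Definition matrix_id_approx N r k (U : 'M[R]_(N, r)) (sk : 'I_k -> 'I_r)
    (P : 'M[R]_(k, r)) : 'M[R]_(N, r) :=
  colsub sk U *m P.

Context {d : nat} {M : 'I_d -> nat} {r : nat}.
Context (C : ctd R M r).

Definition ctd_term (l : 'I_r) : tensor R M := rank_one (ctd_factor C l).

Definition ctd_tensor : tensor R M := \sum_(l < r) ctd_sigma C l *: ctd_term l.

Definition ctd_matrix : 'M[R]_(#|multi_index M|, r) :=
  tensor_cols (fun l => ctd_sigma C l *: ctd_term l).

Context {k : nat} (sk : 'I_k -> 'I_r) (P : 'M[R]_(k, r)).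

Definition tid_coef (m : 'I_k) : R := ctd_sigma C (sk m) * \sum_(l < r) P m l.

Definition tid_tensor : tensor R M :=
  \sum_(m < k) tid_coef m *: ctd_term (sk m).

Definition tid_col (l : 'I_r) : tensor R M :=
  \sum_(m < k) (P m l * ctd_sigma C (sk m)) *: ctd_term (sk m).

Definition tid_matrix : 'M[R]_(#|multi_index M|, r) := tensor_cols tid_col.

Lemma tid_matrixE : tid_matrix = matrix_id_approx ctd_matrix sk P.
Proof.
apply/matrixP => i l; rewrite !mxE sum_ffunE; apply: eq_bigr => m _.
by rewrite !mxE !ffunE /GRing.scale /= -mulrA mulrC.
Qed.

End InterpolativeDecomposition.

(* Main.v *)
(** Entrywise, [ctd_tensor C - tid_tensor C sk P] is the sum of the [r] columns of
    [U - U_k], so Cauchy-Schwarz gives the factor [sqrt r].  Each column of a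
    matrix is its image of a unit vector and is thus bounded by the spectral norm,
    which gives [normF A <= sqrt r * norm2 A]. *)
Require Import Defs.
From mathcomp Require Import all_boot all_order all_algebra.
From mathcomp Require Import reals.
From mathcomp Require Import classical_sets ring.
Import Order.TTheory GRing.Theory Num.Theory.
Local Open Scope ring_scope.

Lemma sqr_sum_mul_le (R : realDomainType) (I : finType) (a b : I -> R) :
  (\sum_i a i * b i) ^+ 2 <= (\sum_i a i ^+ 2) * (\sum_i b i ^+ 2).
Proof.
(* Lagrange's identity *)
suff: (\sum_i a i ^+ 2) * (\sum_i b i ^+ 2) *+ 2
    - (\sum_i a i * b i) ^+ 2 *+ 2 = \sum_i \sum_j (a i * b j - a j * b i) ^+ 2.
  move=> E; rewrite -(ler_pMn2r (n := 2)) // -subr_ge0 E.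
  by apply: sumr_ge0 => i _; apply: sumr_ge0 => j _; apply: sqr_ge0.
have H (f g : I -> R) : (\sum_i f i) * (\sum_i g i) = \sum_i \sum_j f i * g j.
  by rewrite mulr_suml; apply: eq_bigr => i _; rewrite mulr_sumr.
(* Swapping the factors in one of the two copies pairs [a i ^+ 2 * b j ^+ 2] with
   [b i ^+ 2 * a j ^+ 2], so the identity holds term by term in [(i, j)]. *)
rewrite mulr2n {2}[_ * \sum_i b i ^+ 2]mulrC expr2 !H -sumrMnl -big_split -sumrB /=.
apply: eq_bigr => i _; rewrite -sumrMnl -big_split -sumrB /=.
by apply: eq_bigr => j _; ring.
Qed.

(** Cauchy-Schwarz against the constant vector 1, whose squared norm is [#|I|]. *)
Lemma sqr_sum_le (R : realDomainType) (I : finType) (a : I -> R) :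
  (\sum_i a i) ^+ 2 <= #|I|%:R * \sum_i a i ^+ 2.
Proof.
have := @sqr_sum_mul_le _ _ a (fun=> 1).
under eq_bigr do rewrite mulr1.
by under [X in _ <= _ * X -> _]eq_bigr do rewrite expr1n; rewrite sumr_const mulrC.
Qed.

Section Norms.
Context {R : realType}.

Lemma normF_ge0 m n (A : 'M[R]_(m, n)) : 0 <= normF A.
Proof. exact: sqrtr_ge0. Qed.

Lemma sqr_normF m n (A : 'M[R]_(m, n)) :
  normF A ^+ 2 = \sum_i \sum_j A i j ^+ 2.
Proof.
rewrite sqr_sqrtr //.
by apply: sumr_ge0 => i _; apply: sumr_ge0 => j _; apply: sqr_ge0.
Qed.

Lemma sqr_normF_cV m (x : 'cV[R]_m) : normF x ^+ 2 = \sum_i x i 0 ^+ 2.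
Proof. by rewrite sqr_normF; apply: eq_bigr => i _; rewrite big_ord1. Qed.

(** Cauchy-Schwarz on each row of [A]; this bounds the set whose supremum is [norm2 A]. *)
Lemma normF_mulmx_cV m n (A : 'M[R]_(m, n)) (x : 'cV[R]_n) :
  normF (A *m x) <= normF A * normF x.
Proof.
rewrite -(@ler_pXn2r _ 2) ?nnegrE ?mulr_ge0 ?normF_ge0 //.
rewrite exprMn !sqr_normF_cV sqr_normF mulr_suml.
by apply: ler_sum => i _; rewrite mxE sqr_sum_mul_le.
Qed.

Lemma normF_mulmx_le_norm2 m n (A : 'M[R]_(m, n)) (x : 'cV[R]_n) :
  normF x <= 1 -> normF (A *m x) <= norm2 A.
Proof.
move=> x1; apply: ub_le_sup; last by exists x.
exists (normF A) => _ [y /= y1 <-].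
by apply: le_trans (normF_mulmx_cV _ _ _ _) _; rewrite ler_piMr ?normF_ge0.
Qed.

Lemma normF0 m n : normF (0 : 'M[R]_(m, n)) = 0.
Proof.
apply/eqP; rewrite -sqrf_eq0 sqr_normF big1 // => i _.
by rewrite big1 // => j _; rewrite mxE expr0n.
Qed.

Lemma norm2_ge0 m n (A : 'M[R]_(m, n)) : 0 <= norm2 A.
Proof.
(* The zero vector lies in the unit ball even when [n = 0], so its image puts 0 below the
   supremum. *)
by rewrite -(normF0 m 1) -(mulmx0 1 A) normF_mulmx_le_norm2 ?normF0 ?ler01.
Qed.

Lemma normF_delta_cV n (j : 'I_n) : normF (delta_mx j 0 : 'cV[R]_n) = 1.
Proof.
apply/eqP; rewrite -(@eqrXn2 _ 2) ?normF_ge0 ?ler01 // sqr_normF_cV.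
rewrite (bigD1 j) //= big1 => [|i /negPf ij]; rewrite mxE ?ij ?expr0n //.
by rewrite !eqxx addr0.
Qed.

Lemma normF_le_norm2 m n (A : 'M[R]_(m, n)) :
  normF A <= Num.sqrt n%:R * norm2 A.
Proof.
rewrite -(@ler_pXn2r _ 2) ?nnegrE ?mulr_ge0 ?normF_ge0 ?sqrtr_ge0 ?norm2_ge0 //.
rewrite sqr_normF exprMn sqr_sqrtr ?ler0n // exchange_big /=.
(* The factor [n] becomes a sum of [n] equal terms, one for each column of [A]. *)
rewrite mulr_natl -[X in _ *+ X]card_ord -sumr_const.
apply: ler_sum => j _.
have col_le : normF (col j A) <= norm2 A.
  by rewrite colE normF_mulmx_le_norm2 ?normF_delta_cV.
have -> : \sum_i A i j ^+ 2 = normF (col j A) ^+ 2.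
  by rewrite sqr_normF_cV; apply: eq_bigr => i _; rewrite mxE.
by rewrite ler_pXn2r ?nnegrE ?normF_ge0 ?norm2_ge0.
Qed.

Lemma tnormF_sum_le d (M : 'I_d -> nat) r (T : 'I_r -> tensor R M) :
  tnormF (\sum_l T l) <= Num.sqrt r%:R * normF (tensor_cols T).
Proof.
rewrite -(@ler_pXn2r _ 2) ?nnegrE ?mulr_ge0 ?normF_ge0 ?sqrtr_ge0 //.
rewrite exprMn sqr_normF !sqr_sqrtr ?ler0n ?sumr_ge0 // => [|i _]; last exact: sqr_ge0.
(* Multi-indices are renumbered by [enum_val] to match the rows of [tensor_cols T]; Cauchy-Schwarz
   then applies in each row. *)
rewrite mulr_sumr (reindex (@enum_val _ (multi_index M))) /=; last first.
  exact/onW_bij/enum_val_bij.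
apply: ler_sum => i _; rewrite sum_ffunE.
have := @sqr_sum_le _ _ (fun l => T l (enum_val i) : R).
rewrite card_ord => /le_trans; apply.
by under [X in _ <= _ * X]eq_bigr do rewrite !mxE.
Qed.

Lemma tensor_colsB d (M : 'I_d -> nat) r (S T : 'I_r -> tensor R M) :
  tensor_cols (fun l => S l - T l) = tensor_cols S - tensor_cols T.
Proof. by apply/matrixP => i l; rewrite !mxE !ffunE. Qed.

(** Exchanging the sums over [l] and [m] collects row [m] of [P] into [tid_coef]. The tensor error
    thereby becomes a sum of columns of the matrix error. *)
Lemma tid_tensorE d (M : 'I_d -> nat) r k (C : ctd R M r) (sk : 'I_k -> 'I_r)
    (P : 'M[R]_(k, r)) :
  tid_tensor C sk P = \sum_l tid_col C sk P l.
Proof.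
rewrite exchange_big; apply: eq_bigr => m _ /=.
by rewrite -scaler_suml -mulr_suml mulrC.
Qed.

End Norms.

Theorem theorem3p3 (R : realType) (d : nat) (M : 'I_d -> nat) (r k : nat)
    (C : ctd R M r) (sk : 'I_k -> 'I_r) (P : 'M[R]_(k, r))
    (hID : matrix_id_data sk P) :
  tnormF (ctd_tensor C - tid_tensor C sk P)
    <= Num.sqrt r%:R * normF (ctd_matrix C - tid_matrix C sk P) /\
  Num.sqrt r%:R * normF (ctd_matrix C - tid_matrix C sk P)
    <= r%:R * norm2 (ctd_matrix C - tid_matrix C sk P).
Proof.
split; first by rewrite tid_tensorE -sumrB -tensor_colsB tnormF_sum_le.
(* Splitting [r] as a square leaves [normF_le_norm2] multiplied by the square root of [r]. *)
rewrite -[X in X * norm2 _]sqr_sqrtr ?ler0n // expr2 -mulrA.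
by rewrite ler_wpM2l ?sqrtr_ge0 ?normF_le_norm2.
Qed.
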